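(* Let $n\ge 2$, let $A_{\mathfrak t}$ be a nonsingular symmetric real $n\times n$ matrix, and write $x^{\mathfrak t}y:=x^{\mathsf T}A_{\mathfrak t}\,y$ for $x,y\in\mathbb R^n$. Let $\mathsf u$ be a scalar monotonic $C^4$ function on a real interval with $C^4$ inverse $\mathsf s$, and let $\mathsf s_i=\mathsf s^{(i)}$ denote the $i$-th derivative of $\mathsf s$ ($\mathsf s_0=\mathsf s$). Let $\mathcal N\subset\mathbb R^n\times\mathbb R^n$ be an open set of pairs $(x,\bar x)$ with $x^{\mathfrak t}\bar x$ in the domain of $\mathsf u$, on which $\mathsf s_1(\mathsf u(x^{\mathfrak t}\bar x))\neq 0$ and $(\mathsf s_1^2-\mathsf s\,\mathsf s_2)(\mathsf u(x^{\mathfrak t}\bar x))\ne 0$. For $(x,\bar x)\in\mathcal N$ and $\mathring\omega=(\omega,\bar\omega)\in\mathbb R^n\times\mathbb R^n$ set $u=\mathsf u(x^{\mathfrak t}\bar x)$ and $s_i=\mathsf s_i(u)$. Then the cross-curvature (MTW tensor) of the cost $\mathsf c(x,\bar x)=\mathsf u(x^{\mathfrak t}\bar x)$ at $(x,\bar x)$ is $$\mathrm{cross}(\mathring\omega)=\frac{(s_1^2-s_0s_2)s_4+s_0s_3^2-2s_1s_2s_3+s_2^3}{2(s_1^2-s_0s_2)s_1^5}\,\big(\omega^{\mathfrak t}\bar x\;\bar\omega^{\mathfrak t}x\big)^2-\frac{2(s_1s_3-s_2^2)}{s_1^4}\,\big(\omega^{\mathfrak t}\bar x\;\bar\omega^{\mathfrak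 t}x\big)\langle\mathring\omega,\mathring\omega\rangle_{KM}+\frac{s_2}{s_1}\langle\mathring\omega,\mathring\omega\rangle_{KM}^2 .$$ Thus, if $\mathring\omega$ is a null vector ($\langle\mathring\omega,\mathring\omega\rangle_{KM}=0$), then the cross-curvature is nonnegative if and only if $$\frac{(s_1^2-s_0s_2)s_4+s_0s_3^2-2s_1s_2s_3+s_2^3}{2(s_1^2-s_0s_2)s_1^5}\ge 0 .$$ In particular, if $\mathsf s=\mathsf s_0$ satisfies the ODE $$(\mathsf s_1^2-\mathsf s_0\mathsf s_2)\mathsf s_4+\mathsf s_0\mathsf s_3^2-2\mathsf s_1\mathsf s_2\mathsf s_3+\mathsf s_2^3=0,$$ then the cross-curvature is identically zero on null vectors.
   Context: For the cost $\mathsf c(x,\bar x)$, let $D_\omega$ and $\bar D_{\bar\omega}$ denote directional derivatives in the first variable $x$ and second variable $\bar x$ in the (constant) directions $\omega,\bar\omega\in\mathbb R^n$. The Kim-McCann pairing at $(x,\bar x)$ is $$\langle(\omega_1,\bar\omega_1),(\omega_2,\bar\omega_2)\rangle_{KM}=-\tfrac12\big(D_{\omega_1}\bar D_{\bar\omega_2}\mathsf c+\bar D_{\bar\omega_1}D_{\omega_2}\mathsf c\big),$$ so $\langle\mathring\omega,\mathring\omega\rangle_{KM}=-\bar D_{\bar\omega}D_\omega\mathsf c$ for $\mathring\omega=(\omega,\bar\omega)$. When it is nondegenerate, the cross-curvature (MTW tensor) is $$\mathrm{cross}(\mathring\omega)=\tfrac12\big(\bar D_{\bar\omega_\diamond}D_\omega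 D_\omega\mathsf c-D_\omega\bar D_{\bar\omega}\bar D_{\bar\omega}D_\omega\mathsf c\big),$$ where $\bar\omega_\diamond\in\mathbb R^n$ is the unique vector (depending on $(x,\bar x)$ and $\bar\omega$, and held constant in the outer differentiation) satisfying $\bar D_{\bar\omega_\diamond}D_\eta\mathsf c=\bar D_{\bar\omega}\bar D_{\bar\omega}D_\eta\mathsf c$ for all $\eta\in\mathbb R^n$.
   Formalization: For one null vector, ''nonnegative iff the coefficient is ≥ 0'' fails if the product (ω^t x̄)(ω̄^t x) is 0 (e.g. ω̊ = 0); that case is added as an alternative, and the iff is also proved over all null vectors at points with x, x̄ ≠ 0 and over all of N. *)

(* Defs.v *)
From HB Require Import structures.
From mathcomp Require Import all_boot all_order all_algebra.
From mathcomp Require Import all_classical all_reals all_analysis.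
Set Implicit Arguments.
Unset Strict Implicit.
Unset Printing Implicit Defensive.
Import Order.TTheory GRing.Theory Num.Theory numFieldNormedType.Exports.
Local Open Scope ring_scope.
Local Open Scope classical_set_scope.

(* f is of class C^k on a real interval I, which may contain endpoints: the
   library derivatives are two-sided, hence only used on the interior, and
   f, f', ..., f^(k) are required to extend continuously to I (for i = 0 the
   extension is f itself).  For an interval with nonempty interior this is
   equivalent to the definition with one-sided derivatives at the endpoints,
   and for an open interval it is the usual C^k. *)
Definition Ck_on (R : realType) (k : nat) (I : set R) (f : R -> R) : Prop :=
  [/\ {within I, continuous f},
      forall i t, (i < k)%N -> I° t -> derivable (f^`(i)) t 1
    & forall i, (i <= k)%N -> exists2 g : R -> R,
        {within I, continuous g} & forall t, I° t -> g t = f^`(i) t].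

Definition monotonic_on (R : realType) (I : set R) (f : R -> R) : Prop :=
  {in I &, {homo f : p q / p <= q}} \/ {in I &, {homo f : p q /~ p <= q}}.

Section CrossCurvature.
Variables (R : realType) (n : nat).
Local Notation V := 'cV[R]_n.
Implicit Types (c : V -> V -> R) (x xb v : V) (w : V * V).

Definition D1 v c : V -> V -> R := fun x xb => 'D_v (fun y => c y xb) x.

Definition D2 v c : V -> V -> R := fun x xb => 'D_v (c x) xb.

Definition KM c x xb w1 w2 : R :=
  - (1 / 2) * (D1 w1.1 (D2 w2.2 c) x xb + D2 w1.2 (D1 w2.1 c) x xb).

Definition KM_nondegenerate c x xb : Prop :=
  forall w1, (forall w2, KM c x xb w1 w2 = 0) -> w1 = 0.

Definition is_diamond c x xb v vd : Prop :=
  forall eta : V, D2 vd (D1 eta c) x xb = D2 v (D2 v (D1 eta c)) x xb.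

(* The vector v_diamond; when the pairing is nondegenerate at (x, xb) it is the
   unique vd with [is_diamond c x xb v vd].  It is computed at the given point
   (x, xb), so it stays constant in the differentiation in [cross]. *)
Definition diamond c x xb v : V := xget 0 [set vd | is_diamond c x xb v vd].

Definition cross c x xb w : R :=
  1 / 2 * (D2 (diamond c x xb w.2) (D1 w.1 (D1 w.1 c)) x xb
           - D1 w.1 (D2 w.2 (D2 w.2 (D1 w.1 c))) x xb).

Definition null_vector c x xb w : Prop := KM c x xb w w = 0.

Definition tprod (A : 'M[R]_n) (x y : V) : R := (x^T *m A *m y) 0 0.

End CrossCurvature.

Section Coefficients.
Variables (R : realType) (s : R -> R).

Definition mtw_den (t : R) : R := (s^`(1) t)%classic ^+ 2 - s t * (s^`(2) t)%classic.

Definition mtw_num (t : R) : R :=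
  let s0 := s t in
  let s1 := (s^`(1) t)%classic in
  let s2 := (s^`(2) t)%classic in
  let s3 := (s^`(3) t)%classic in
  let s4 := (s^`(4) t)%classic in
  (s1 ^+ 2 - s0 * s2) * s4 + s0 * s3 ^+ 2 - 2 * s1 * s2 * s3 + s2 ^+ 3.

Definition mtw_coef (t : R) : R :=
  mtw_num t / (2 * mtw_den t * (s^`(1) t)%classic ^+ 5).

End Coefficients.

(* Main.v *)
(* All derivatives of c = u(x^t xb) are polynomials in the numbers u^(i)(t),
   t = x^t xb, and p = w.1^t xb, q = w.2^t x, r = w.1^t w.2.  Since
   <w, w>_KM = - (u'' p q + u' r), eliminating r in favour of <w, w>_KM and the
   u^(i)(t) in favour of the s_i (by differentiating s (u t) = t) gives the formula.
   On a null vector only the (p q)^2 term survives, and for x, xb <> 0 and n >= 2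
   there are null vectors with p q <> 0.  If x or xb vanishes, it can be moved inside
   N to a nonzero vector without changing t, which also shows that t is always
   interior to I. *)
Require Import Defs.
From mathcomp Require Import all_boot all_order all_algebra.
From mathcomp Require Import all_classical all_reals all_analysis.
From mathcomp Require Import ring lra.
Import Order.TTheory GRing.Theory Num.Theory numFieldNormedType.Exports.
Local Open Scope ring_scope.
Local Open Scope classical_set_scope.

(** * Directional derivatives as derivatives in one real variable *)

Section LineDerivative.
Set Implicit Arguments.
Unset Strict Implicit.
Variables (R : realType) (V : normedModType R).
Implicit Types (f : V -> R) (v x : V) (g : R -> R).

Lemma derive_line f v x : 'D_v f x = 'D_1 (fun h : R => f (h *: v + x)) 0.
Proof.
rewrite /derive.
under [in RHS]eq_fun do rewrite /= addr0 scale0r add0r /GRing.scale /= mulr1.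
by [].
Qed.

(** Agreement near [0] is enough because a derivative is local; closed forms for the iterated
    derivatives of the cost hold only on an open set. *)
Lemma derive_line_eq f v x g (d : R) :
  (\forall h \near (0 : R), f (h *: v + x) = g h) ->
  is_derive (0 : R) 1 g d -> 'D_v f x = d.
Proof.
by move=> fg gd; rewrite derive_line (near_eq_derive _ fg) derive_val.
Qed.

End LineDerivative.

(** * One-variable differentiation rules with explicit values *)

Section ScalarRules.
Set Implicit Arguments.
Unset Strict Implicit.
Variable R : realType.
Implicit Types (f g : R -> R) (x a b d e : R).

Lemma is_derive_affine x a b : is_derive x 1 (fun h : R => h * a + b) a.
Proof.
apply: (@is_derive_eq _ _ _ ((@id R) * cst a + cst b) x 1 a).
by rewrite scaler0 add0r addr0 /GRing.scale /= mulr1.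
Qed.

Lemma is_derive_comp_affine f x a b d :
  is_derive (x * a + b) 1 f d -> is_derive x 1 (fun h => f (h * a + b)) (d * a).
Proof.
by move=> fd; exact: (is_derive1_comp (g := fun h => h * a + b) fd (is_derive_affine x a b)).
Qed.

Lemma is_derive_mul f g x d e :
  is_derive x 1 f d -> is_derive x 1 g e ->
  is_derive x 1 (fun h => f h * g h) (f x * e + g x * d).
Proof. by move=> fd ge; exact: is_deriveM. Qed.

Lemma is_derive_add f g x d e :
  is_derive x 1 f d -> is_derive x 1 g e ->
  is_derive x 1 (fun h => f h + g h) (d + e).
Proof. by move=> fd ge; exact: is_deriveD. Qed.

End ScalarRules.

(** * Bilinearity and symmetry of the form given by [A] *)

Section TProd.
Set Implicit Arguments.
Unset Strict Implicit.
Variables (R : realType) (n : nat) (A : 'M[R]_n).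
Implicit Types (x y z : 'cV[R]_n) (a : R).

Lemma tprodDl x y z : tprod A (x + y) z = tprod A x z + tprod A y z.
Proof. by rewrite /tprod linearD /= !mulmxDl mxE. Qed.
Lemma tprodZl a x z : tprod A (a *: x) z = a * tprod A x z.
Proof. by rewrite /tprod linearZ /= -!scalemxAl mxE. Qed.
Lemma tprodDr x y z : tprod A z (x + y) = tprod A z x + tprod A z y.
Proof. by rewrite /tprod mulmxDr mxE. Qed.
Lemma tprodZr a x z : tprod A z (a *: x) = a * tprod A z x.
Proof. by rewrite /tprod -scalemxAr mxE. Qed.
Lemma tprod0l z : tprod A 0 z = 0.
Proof. by rewrite -(scale0r 0) tprodZl mul0r. Qed.
Lemma tprod0r z : tprod A z 0 = 0.
Proof. by rewrite -(scale0r 0) tprodZr mul0r. Qed.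
Lemma tprodC x y : A^T = A -> tprod A x y = tprod A y x.
Proof.
(* The scalar y^T A x is read as the entry of its 1 by 1 transpose, which is x^T A y since [A] is
   symmetric. *)
move=> As; rewrite /tprod -[RHS](mxE trmx_key (fun i j => (y^T *m A *m x) j i)).
by rewrite -/(trmx _) !trmx_mul trmxK As mulmxA.
Qed.

Lemma tprod_dot x y : tprod A x y = tprod 1%:M x (A *m y).
Proof. by rewrite /tprod mulmx1 mulmxA. Qed.

End TProd.

(** * Choice of vectors with prescribed pairings, and motions inside [N] *)

Section Geometry.
Set Implicit Arguments.
Unset Strict Implicit.
Variables (R : realType) (n : nat).
Implicit Types (A : 'M[R]_n) (x y z : 'cV[R]_n) (a : R).

Lemma dot_gt0 x : x != 0 -> 0 < tprod 1%:M x x.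
Proof.
move=> x0.
have E : tprod 1%:M x x = \sum_i x i 0 ^+ 2.
  by rewrite /tprod mulmx1 mxE; apply: eq_bigr => i _; rewrite mxE expr2.
have : exists i, x i 0 != 0.
  apply/existsP; apply: contra_neqT x0 => /existsPn x0.
  by apply/matrixP => i j; rewrite ord1 mxE; apply/eqP; rewrite -[_ == _]negbK x0.
case=> i xi; rewrite E (bigD1 i) //= ltr_pwDl //.
  by rewrite lt0r sqrf_eq0 xi sqr_ge0.
by apply: sumr_ge0 => j _; exact: sqr_ge0.
Qed.

Lemma tprod_nondegenerate A x :
  A \in unitmx -> x != 0 -> exists z, tprod A x z != 0.
Proof.
(* This [z] turns the pairing into the Euclidean square of [x]. *)
move=> Au x0; exists (invmx A *m x).
by rewrite tprod_dot mulKVmx // gt_eqF ?dot_gt0.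
Qed.

(** The column [A *m y] has rank at most 1, which is less than [n], so its left kernel is
    nonzero. *)
Lemma exists_orthogonal A y : (2 <= n)%N -> exists2 v, v != 0 & tprod A v y = 0.
Proof.
move=> n2; have : kermx (A *m y) != 0.
  rewrite -mxrank_eq0 mxrank_ker subn_eq0 -ltnNge.
  exact: leq_ltn_trans (rank_leq_col _) n2.
case/rowV0Pn => v /sub_kermxP vy v0; exists v^T.
  by apply: contra_neq v0 => vT0; rewrite -(trmxK v) vT0 trmx0.
by rewrite /tprod trmxK -mulmxA vy mxE.
Qed.

(** The vector [x] itself works unless it is orthogonal to [y]; in that case [x + y] does. *)
Lemma exists_common_nonorthogonal x y :
  x != 0 -> y != 0 -> exists2 z, tprod 1%:M z x != 0 & tprod 1%:M z y != 0.
Proof.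
move=> /dot_gt0 xx /dot_gt0 yy.
have C : tprod 1%:M x y = tprod 1%:M y x by apply: tprodC; rewrite trmx1.
have [xy|xy] := eqVneq (tprod 1%:M x y) 0.
  by exists (x + y); rewrite !tprodDl -?C xy ?addr0 ?add0r gt_eqF.
by exists x => //; rewrite gt_eqF.
Qed.

(** This supplies null vectors: being null prescribes the ratio [k] of r to p q. Take [f] orthogonal
    to [x] and [w.2 = A^-1 (x + b f)]. Then q is the square of [x] whatever [b] is, while r is
    affine in [b] with slope z.f, nonzero by the choice of [z = w.1]. *)
Lemma exists_tprod_pair A x xb (k : R) :
    (2 <= n)%N -> A \in unitmx -> A^T = A -> x != 0 -> xb != 0 ->
  exists w : 'cV[R]_n * 'cV[R]_n,
    [/\ tprod A w.1 xb != 0, tprod A w.2 x != 0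
      & tprod A w.1 w.2 = k * (tprod A w.1 xb * tprod A w.2 x)].
Proof.
move=> n2 Au As x0 xb0.
have Axb0 : A *m xb != 0.
  by apply: contra_neq xb0 => H; rewrite -(mulKmx Au xb) H mulmx0.
have [f f0 fx] := exists_orthogonal 1%:M x n2.
have [z zxb zf] := exists_common_nonorthogonal Axb0 f0.
have xx := dot_gt0 x0.
pose p := tprod 1%:M z (A *m xb); pose q := tprod 1%:M x x.
(* The solution of z.x + b (z.f) = k p q. *)
pose b := (k * (p * q) - tprod 1%:M z x) / tprod 1%:M z f.
have E v : tprod A v (invmx A *m (x + b *: f)) = tprod 1%:M v x + b * tprod 1%:M v f.
  by rewrite tprod_dot mulKVmx // tprodDr tprodZr.
have xf : tprod 1%:M x f = 0 by rewrite tprodC ?trmx1.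
have Eq : tprod A (invmx A *m (x + b *: f)) x = q.
  by rewrite tprodC // E xf mulr0 addr0.
exists (z, invmx A *m (x + b *: f)) => /=; rewrite Eq tprod_dot; split => //.
  by rewrite gt_eqF.
by rewrite E /b divfK // addrC subrK.
Qed.

Variable (A : 'M[R]_n).
Variables (N : set ('cV[R]_n * 'cV[R]_n)) (I : set R).
Hypotheses (n2 : (2 <= n)%N) (Au : A \in unitmx) (As : A^T = A).
Hypotheses (oN : open N) (NI : forall x xb, N (x, xb) -> I (tprod A x xb)).

Lemma near_translate x xb v w : N (x, xb) ->
  \forall h \near (0 : R), N (h *: v + x, h *: w + xb).
Proof.
move=> Nx; have lin y z : (fun h : R => h *: y + z) @ (0 : R) --> z.
  rewrite -[X in _ --> X]add0r -[X in X + _](scale0r y).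
  by apply: cvgD; [apply: cvgZr_tmp; exact: cvg_id | exact: cvg_cst].
apply: (cvg_pair (lin v x) (lin w xb)).
by apply: (@open_nbhs_nbhs _ (x, xb)); split.
Qed.

Lemma near_nonzero (P : R -> Prop) :
  (\forall h \near (0 : R), P h) -> exists2 h, h != 0 & P h.
Proof.
move=> /nbhs_dnbhs P0.
have /filter_ex [h [h0 Ph]] : \forall h \near 0^', h != 0 /\ P h.
  by near=> h; split; near: h => //; exact: nbhs_dnbhs_neq.
by exists h.
Unshelve. all: by end_near. Qed.

Lemma exists_nonzero_same_tprod x xb : N (x, xb) ->
  exists y yb, [/\ N (y, yb), y != 0, yb != 0 & tprod A y yb = tprod A x xb].
Proof.
move=> Nx.
have [y [Ny y0 yt]] : exists y, [/\ N (y, xb), y != 0 & tprod A y xb = tprod A x xb].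
  have [x0|] := eqVneq x 0; last by exists x.
  (* Moving [x] along a direction that pairs to zero with [xb] keeps the product fixed; a small
     nonzero multiple stays in the open set [N]. *)
  have [v v0 vxb] := exists_orthogonal A xb n2.
  have [h h0] := near_nonzero (near_translate v 0 Nx).
  rewrite scaler0 add0r x0 addr0 => Nh; exists (h *: v).
  by rewrite scaler_eq0 negb_or h0 v0 tprodZl vxb tprod0l mulr0.
have [xb0|] := eqVneq xb 0; last by exists y, xb.
have [v v0 vy] := exists_orthogonal A y n2.
have [h h0] := near_nonzero (near_translate 0 v Ny).
rewrite scaler0 add0r {1}xb0 addr0 => Nh; exists y, (h *: v).
by rewrite scaler_eq0 negb_or h0 v0 -yt xb0 tprodZr tprodC // vy tprod0r mulr0.
Qed.

(** Once the first vector [y] is nonzero, moving the second along some [v] with y^t v nonzero makes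
    the product sweep a neighbourhood of its value, all inside [I]. *)
Lemma tprod_interior x xb : N (x, xb) -> I° (tprod A x xb).
Proof.
case/exists_nonzero_same_tprod => y [yb [Ny y0 _ <-]].
have [v yv] := tprod_nondegenerate Au y0.
set k := tprod A y v in yv; set t := tprod A y yb.
(* Shifting [yb] by [(r - t) / k] times [v] makes the product exactly [r], and this shift tends to 0
   as [r] tends to [t]. *)
have : (fun r : R => (r - t) * k^-1) @ t --> (t - t) * k^-1.
  by apply: cvgM; [apply: cvgB; [exact: cvg_id | exact: cvg_cst] | exact: cvg_cst].
rewrite subrr mul0r => lim0.
have : \forall r \near t, N ((r - t) * k^-1 *: 0 + y, (r - t) * k^-1 *: v + yb).
  exact: lim0 (near_translate 0 v Ny).
apply: filterS => r /= /NI.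
by rewrite scaler0 add0r tprodDr tprodZr divfK // subrK.
Qed.

End Geometry.

(** * Derivatives of u and of its inverse *)

Section Jets.
Set Implicit Arguments.
Unset Strict Implicit.
Variable R : realType.
Implicit Types (I J : set R) (f u s : R -> R) (t : R).

Lemma Ck_is_derive k I f i t : Ck_on k I f -> (i < k)%N -> I° t ->
  is_derive t 1 (f^`(i))%classic ((f^`(i.+1))%classic t).
Proof.
by case=> _ df _ ik It; split; [exact: df | rewrite derive1nS derive1E].
Qed.

(** A closed interval of half radius around [t] fits in [I]. Injectivity makes the monotonicity
    strict, so [u t] lies strictly between the two endpoint values, and the intermediate value
    theorem puts everything between these in the image. *)
Lemma interior_image I u t : monotonic_on I u -> {within I, continuous u} ->
  {in I &, injective u} -> I° t -> (u @` I)° (u t).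
Proof.
move=> um uc ui It.
have /nbhs_ballP [e /= e0 eI] : nbhs t I by exact: It.
have e2 : 0 < e / 2 by rewrite divr_gt0.
have sub r : r \in `[t - e / 2, t + e / 2]%R -> I r.
  rewrite in_itv /= => /andP[r1 r2]; apply: eI; rewrite /ball /= ltr_distlC.
  by apply/andP; split; lra.
pose a := t - e / 2; pose b := t + e / 2.
have [aI tI bI] : [/\ I a, I t & I b].
  by split; apply: sub; rewrite in_itv /= /a /b; apply/andP; split; lra.
have ab : a <= b by rewrite /a /b; lra.
have img : forall v, Num.min (u a) (u b) <= v <= Num.max (u a) (u b) -> (u @` I) v.
  move=> v vab; have [|r rab <-] := IVT ab _ vab.
    by apply: continuous_subspaceW uc => r; exact: sub.
  by exists r => //; exact: sub.
have neq p q : I p -> I q -> p < q -> u p != u q.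
  move=> Ip Iq pq; apply: contraTneq pq => /ui; rewrite !inE => -> //.
  by rewrite ltxx.
have strict : Num.min (u a) (u b) < u t < Num.max (u a) (u b).
  have uat : u a != u t by apply: neq; rewrite /a //; lra.
  have utb : u t != u b by apply: neq; rewrite /b //; lra.
  case: um => um.
    have lat : u a < u t by rewrite lt_neqAle uat um ?inE // /a; lra.
    have ltb : u t < u b by rewrite lt_neqAle utb um ?inE // /b; lra.
    by rewrite gt_min lt_max lat ltb orbT.
  have lat : u t < u a by rewrite lt_neqAle eq_sym uat um ?inE // /a; lra.
  have ltb : u b < u t by rewrite lt_neqAle eq_sym utb um ?inE // /b; lra.
  by rewrite gt_min lt_max lat ltb orbT.
rewrite /interior /=; case/andP: strict => lo hi.
near=> v; apply: img; apply/andP; split; apply: ltW; near: v.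
  exact: lt_nbhsr.
exact: lt_nbhsl.
Unshelve. all: by end_near. Qed.

Lemma is_derive_near_const f t (d k : R) :
  is_derive t 1 f d -> (\forall r \near t, f r = k) -> d = 0.
Proof.
move=> fd fk; rewrite -(derive_val (is_derive := fd)).
by rewrite (near_eq_derive (g := cst k) _ fk) derive_cst.
Qed.

(** Here [S i] stands for s_i composed with u, whence the factor [U 1] in its derivative. The four
    identities come from differentiating s(u(t)) = t on the open set [J] one to four times. *)
Lemma inverse_jet J (U S : nat -> R -> R) :
    open J ->
    (forall i r, (i < 4)%N -> J r -> is_derive r 1 (U i) (U i.+1 r)) ->
    (forall i r, (i < 4)%N -> J r -> is_derive r 1 (S i) (S i.+1 r * U 1%N r)) ->
    (forall r, J r -> S 0%N r = r) ->
  forall t, J t ->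
  [/\ S 1%N t * U 1%N t = 1,
      S 2%N t * U 1%N t ^+ 2 + S 1%N t * U 2%N t = 0,
      S 3%N t * U 1%N t ^+ 3 + 3 * (S 2%N t * U 1%N t * U 2%N t) + S 1%N t * U 3%N t = 0
    & S 4%N t * U 1%N t ^+ 4 + 6 * (S 3%N t * U 1%N t ^+ 2 * U 2%N t)
        + S 2%N t * (3 * U 2%N t ^+ 2 + 4 * (U 1%N t * U 3%N t)) + S 1%N t * U 4%N t = 0].
Proof.
move=> oJ dU dS S0 t Jt.
have nearJ (P : R -> Prop) : (forall r, J r -> P r) ->
    forall r, J r -> \forall r' \near r, P r'.
  move=> JP r Jr; apply: filterS JP _.
  by apply: (@open_nbhs_nbhs _ r); split.
have E1 r : J r -> S 1%N r * U 1%N r = 1.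
  move=> Jr; apply/eqP; rewrite -subr_eq0; apply/eqP.
  apply: (@is_derive_near_const (fun q => S 0%N q - q) r _ 0).
    by apply: is_deriveB; exact: dS.
  by apply: nearJ Jr => q Jq; rewrite S0 // subrr.
have E2 r : J r -> S 2%N r * U 1%N r ^+ 2 + S 1%N r * U 2%N r = 0.
  move=> Jr; have [d1 e1] := (dU 1%N r isT Jr, dS 1%N r isT Jr).
  rewrite -(is_derive_near_const (is_derive_mul e1 d1) (nearJ _ E1 _ Jr)).
  by lazy beta; ring.
have E3 r : J r ->
    S 3%N r * U 1%N r ^+ 3 + 3 * (S 2%N r * U 1%N r * U 2%N r) + S 1%N r * U 3%N r = 0.
  move=> Jr; have [d1 d2] := (dU 1%N r isT Jr, dU 2%N r isT Jr).
  have [e1 e2] := (dS 1%N r isT Jr, dS 2%N r isT Jr).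
  (* The square is spelled out as a product, so that the product and sum rules suffice. *)
  have D := is_derive_add (is_derive_mul e2 (is_derive_mul d1 d1)) (is_derive_mul e1 d2).
  rewrite -(is_derive_near_const D (nearJ _ E2 _ Jr)).
  by lazy beta; ring.
split; [exact: E1 | exact: E2 | exact: E3 |].
have [d1 d2 d3] := And3 (dU 1%N t isT Jt) (dU 2%N t isT Jt) (dU 3%N t isT Jt).
have [e1 e2 e3] := And3 (dS 1%N t isT Jt) (dS 2%N t isT Jt) (dS 3%N t isT Jt).
have D := is_derive_add (is_derive_add
  (is_derive_mul e3 (is_derive_mul d1 (is_derive_mul d1 d1)))
  (is_derive_mul (is_derive_cst (3 : R) t 1)
    (is_derive_mul e2 (is_derive_mul d1 d2)))) (is_derive_mul e1 d3).
rewrite -(is_derive_near_const D (k := 0)).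
  by rewrite /cst; lazy beta; ring.
by apply: nearJ Jt => q Jq; rewrite -(E3 q Jq) /cst; ring.
Qed.

End Jets.

(** * Iterated directional derivatives of the cost *)

Section CostDerivatives.
Set Implicit Arguments.
Unset Strict Implicit.
Variables (R : realType) (n : nat) (A : 'M[R]_n) (J : set R) (U : nat -> R -> R).
Hypothesis oJ : open J.
Hypothesis dU : forall i t, (i < 4)%N -> J t ->
  is_derive t 1 (U i) (U i.+1 t).
Implicit Types (x xb v w eta : 'cV[R]_n) (t p : R).
Local Notation "<| x , y |>" := (tprod A x y).
Local Notation c := (fun x xb : 'cV[R]_n => U 0%N (tprod A x xb)).

Lemma near_affine t p : J t -> \forall h \near (0 : R), J (h * p + t).
Proof.
move=> Jt; have lim : (fun h : R => h * p + t) @ (0 : R) --> t.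
  rewrite -[X in _ --> X]add0r -[X in X + _](mul0r p).
  by apply: cvgD; [apply: cvgM; [exact: cvg_id | exact: cvg_cst] | exact: cvg_cst].
by apply: lim; apply: (@open_nbhs_nbhs _ t); split.
Qed.

Lemma is_derive_jet i p t : (i < 4)%N -> J t ->
  is_derive (0 : R) 1 (fun h => U i (h * p + t)) (U i.+1 t * p).
Proof.
move=> i4 Jt; apply: is_derive_comp_affine.
by rewrite mul0r add0r; exact: dU.
Qed.

(** Near [h = 0] the product stays in the open set [J], so a closed form of [F] valid only there can
    be differentiated once more; this makes the iteration possible. *)
Lemma D1_line (F : 'cV[R]_n -> 'cV[R]_n -> R) v x xb (g : R -> R) d :
    J <|x, xb|> -> (forall y, J <|y, xb|> -> forall h, y = h *: v + x -> F y xb = g h) ->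
    is_derive (0 : R) 1 g d -> D1 v F x xb = d.
Proof.
move=> Jx Fg; apply: derive_line_eq.
apply: filterS (near_affine <|v, xb|> Jx) => h Jh.
by apply: Fg => //; rewrite tprodDl tprodZl.
Qed.

Lemma D2_line (F : 'cV[R]_n -> 'cV[R]_n -> R) v x xb (g : R -> R) d :
    J <|x, xb|> -> (forall y, J <|x, y|> -> forall h, y = h *: v + xb -> F x y = g h) ->
    is_derive (0 : R) 1 g d -> D2 v F x xb = d.
Proof.
move=> Jx Fg; apply: derive_line_eq.
apply: filterS (near_affine <|x, v|> Jx) => h Jh.
by apply: Fg => //; rewrite tprodDr tprodZr.
Qed.

Lemma D1_cost v x xb : J <|x, xb|> -> D1 v c x xb = U 1%N <|x, xb|> * <|v, xb|>.
Proof.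
move=> Jx; apply: (D1_line Jx (g := fun h => U 0%N (h * <|v, xb|> + <|x, xb|>))).
  by move=> y _ h ->; rewrite tprodDl tprodZl.
exact: is_derive_jet.
Qed.

Lemma D2_cost v x xb : J <|x, xb|> -> D2 v c x xb = U 1%N <|x, xb|> * <|x, v|>.
Proof.
move=> Jx; apply: (D2_line Jx (g := fun h => U 0%N (h * <|x, v|> + <|x, xb|>))).
  by move=> y _ h ->; rewrite tprodDr tprodZr.
exact: is_derive_jet.
Qed.

Lemma D1_D2_cost w v x xb : J <|x, xb|> ->
  D1 w (D2 v c) x xb = U 2%N <|x, xb|> * <|w, xb|> * <|x, v|> + U 1%N <|x, xb|> * <|w, v|>.
Proof.
(* Along the line the inner derivative is [U 1] at an affine argument times an affine factor. The
   higher derivatives follow the same pattern, with sums of such products and constants. *)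
move=> Jx; have d := is_derive_mul (is_derive_jet <|w, xb|> (isT : 1 < 4)%N Jx)
  (is_derive_affine 0 <|w, v|> <|x, v|>).
rewrite (D1_line Jx _ d); first by rewrite !mul0r !add0r; ring.
by move=> y Jy h yE; rewrite D2_cost // yE !tprodDl !tprodZl.
Qed.

Lemma D2_D1_cost v eta x xb : J <|x, xb|> ->
  D2 v (D1 eta c) x xb =
    U 2%N <|x, xb|> * <|eta, xb|> * <|x, v|> + U 1%N <|x, xb|> * <|eta, v|>.
Proof.
move=> Jx; have d := is_derive_mul (is_derive_jet <|x, v|> (isT : 1 < 4)%N Jx)
  (is_derive_affine 0 <|eta, v|> <|eta, xb|>).
rewrite (D2_line Jx _ d); first by rewrite !mul0r !add0r; ring.
by move=> y Jy h yE; rewrite D1_cost // yE !tprodDr !tprodZr.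
Qed.

Lemma D1_D1_cost v x xb : J <|x, xb|> ->
  D1 v (D1 v c) x xb = U 2%N <|x, xb|> * <|v, xb|> ^+ 2.
Proof.
move=> Jx; have d := is_derive_mul (is_derive_jet <|v, xb|> (isT : 1 < 4)%N Jx)
  (is_derive_cst <|v, xb|> (0 : R) 1).
rewrite (D1_line Jx _ d); first by rewrite !mul0r !add0r /cst; ring.
by move=> y Jy h yE; rewrite D1_cost // yE !tprodDl !tprodZl.
Qed.

Lemma D2_D1_D1_cost v w x xb : J <|x, xb|> ->
  D2 v (D1 w (D1 w c)) x xb =
    U 3%N <|x, xb|> * <|w, xb|> ^+ 2 * <|x, v|>
    + 2 * U 2%N <|x, xb|> * <|w, xb|> * <|w, v|>.
Proof.
move=> Jx; have a := is_derive_affine 0 <|w, v|> <|w, xb|>.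
have d := is_derive_mul (is_derive_jet <|x, v|> (isT : 2 < 4)%N Jx) (is_derive_mul a a).
rewrite (D2_line Jx _ d); first by rewrite !mul0r !add0r; ring.
by move=> y Jy h yE; rewrite D1_D1_cost // yE !tprodDr !tprodZr.
Qed.

Lemma D2_D2_D1_cost v eta x xb : J <|x, xb|> ->
  D2 v (D2 v (D1 eta c)) x xb =
    U 3%N <|x, xb|> * <|eta, xb|> * <|x, v|> ^+ 2
    + 2 * U 2%N <|x, xb|> * <|x, v|> * <|eta, v|>.
Proof.
move=> Jx; have k b := is_derive_cst (b : R) (0 : R) 1.
have d := is_derive_add
  (is_derive_mul (is_derive_jet <|x, v|> (isT : 2 < 4)%N Jx)
    (is_derive_mul (is_derive_affine 0 <|eta, v|> <|eta, xb|>) (k <|x, v|>)))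
  (is_derive_mul (is_derive_jet <|x, v|> (isT : 1 < 4)%N Jx) (k <|eta, v|>)).
rewrite (D2_line Jx _ d); first by rewrite !mul0r !add0r /cst; ring.
by move=> y Jy h yE; rewrite D2_D1_cost // yE !tprodDr !tprodZr mulrA.
Qed.

Lemma D1_D2_D2_D1_cost v w x xb : J <|x, xb|> ->
  D1 w (D2 v (D2 v (D1 w c))) x xb =
    U 4%N <|x, xb|> * (<|w, xb|> * <|x, v|>) ^+ 2
    + 4 * U 3%N <|x, xb|> * <|w, xb|> * <|x, v|> * <|w, v|>
    + 2 * U 2%N <|x, xb|> * <|w, v|> ^+ 2.
Proof.
move=> Jx; have k b := is_derive_cst (b : R) (0 : R) 1.
have a := is_derive_affine 0 <|w, v|> <|x, v|>.
have d := is_derive_add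
  (is_derive_mul (is_derive_mul (is_derive_jet <|w, xb|> (isT : 3 < 4)%N Jx)
    (k <|w, xb|>)) (is_derive_mul a a))
  (is_derive_mul (is_derive_mul (is_derive_mul (k 2)
    (is_derive_jet <|w, xb|> (isT : 2 < 4)%N Jx)) a) (k <|w, v|>)).
rewrite (D1_line Jx _ d); first by rewrite !mul0r !add0r /cst; ring.
by move=> y Jy h yE; rewrite D2_D2_D1_cost // yE !tprodDl !tprodZl.
Qed.

(** * The pairing, the vector v_diamond and the cross-curvature of the cost *)

Hypotheses (Au : A \in unitmx) (As : A^T = A).

Lemma KM_cost x xb (w1 w2 : 'cV[R]_n * 'cV[R]_n) : J <|x, xb|> ->
  KM c x xb w1 w2 = - (1 / 2) *
    (U 2%N <|x, xb|> * (<|w1.1, xb|> * <|x, w2.2|> + <|w2.1, xb|> * <|x, w1.2|>)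
     + U 1%N <|x, xb|> * (<|w1.1, w2.2|> + <|w2.1, w1.2|>)).
Proof. by move=> Jx; rewrite /KM D1_D2_cost // D2_D1_cost //; ring. Qed.

Lemma tprod_eq0l z : (forall y, <|z, y|> = 0) -> z = 0.
Proof.
move=> z0; apply/eqP; apply: contraT => /(tprod_nondegenerate Au)[y].
by rewrite z0 eqxx.
Qed.

(** Testing a kernel vector [(a, b)] against [(0, y)] and [(y, 0)] decouples its components. The
    choices [y = xb] and [y = x] give [<|a, xb|> = 0] and [<|x, b|> = 0]; then [a] and [b] pair to
    zero with every vector. *)
Lemma cost_KM_nondegenerate x xb : J <|x, xb|> -> U 1%N <|x, xb|> != 0 ->
  U 2%N <|x, xb|> * <|x, xb|> + U 1%N <|x, xb|> != 0 -> KM_nondegenerate c x xb.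
Proof.
move=> Jx u1 den [a b] K0; set a1 := U 1%N _ in u1 den K0; set a2 := U 2%N _ in den K0.
have Ka y : a2 * <|a, xb|> * <|x, y|> + a1 * <|a, y|> = 0.
  have := K0 (0, y); rewrite KM_cost //= !tprod0l -/a1 -/a2 => K0y.
  by lra.
have Kb y : a2 * <|y, xb|> * <|x, b|> + a1 * <|y, b|> = 0.
  have := K0 (y, 0); rewrite KM_cost //= !tprod0r -/a1 -/a2 => K0y.
  by lra.
have axb : <|a, xb|> = 0.
  apply/(mulfI den); rewrite mulr0 -[RHS](Ka xb) -/a1; ring.
have xb0 : <|x, b|> = 0.
  apply/(mulfI den); rewrite mulr0 -[RHS](Kb x) -/a1; ring.
congr pair; apply: tprod_eq0l => y.
  by apply/(mulfI u1); rewrite mulr0 -[RHS](Ka y) axb; ring.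
by rewrite tprodC //; apply/(mulfI u1); rewrite mulr0 -[RHS](Kb y) xb0; ring.
Qed.

Lemma cost_diamond x xb v : J <|x, xb|> -> U 1%N <|x, xb|> != 0 ->
  U 2%N <|x, xb|> * <|x, xb|> + U 1%N <|x, xb|> != 0 ->
  is_diamond c x xb v (diamond c x xb v).
Proof.
move=> Jx u1 den; rewrite /diamond; apply: xgetPex.
set a1 := U 1%N _ in u1 den; set a2 := U 2%N _ in den; set a3 := U 3%N <|x, xb|>.
pose q := <|x, v|>; pose t := <|x, xb|>.
(* Setting [eta = x] in the defining equation forces this value of the product of [x] with
   v_diamond; given it, the equation for all [eta] determines the witness below. *)
pose d := q ^+ 2 * (a3 * t + 2 * a2) / (a2 * t + a1).
exists ((a3 * q ^+ 2 - a2 * d) / a1 *: xb + 2 * a2 * q / a1 *: v) => eta.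
rewrite D2_D1_cost // D2_D2_D1_cost // !tprodDr !tprodZr.
rewrite -/a1 -/a2 -/a3 -/q -/t /d; field.
by rewrite -/t in den; rewrite den u1.
Qed.

(* The vector v_diamond only enters through its products with [x] and [w.1], here
   [d] and [e]; both follow from its defining equation at [x] and [w.1]. *)
Lemma cross_cost x xb (w : 'cV[R]_n * 'cV[R]_n) : J <|x, xb|> -> U 1%N <|x, xb|> != 0 ->
  U 2%N <|x, xb|> * <|x, xb|> + U 1%N <|x, xb|> != 0 ->
  let a i := U i <|x, xb|> in
  let p := <|w.1, xb|> in let q := <|x, w.2|> in let r := <|w.1, w.2|> in
  let d := q ^+ 2 * (a 3%N * <|x, xb|> + 2 * a 2%N) / (a 2%N * <|x, xb|> + a 1%N) in
  let e := (a 3%N * p * q ^+ 2 + 2 * a 2%N * q * r - a 2%N * p * d) / a 1%N in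
  cross c x xb w = 1 / 2 * (a 3%N * p ^+ 2 * d + 2 * a 2%N * p * e
    - (a 4%N * (p * q) ^+ 2 + 4 * a 3%N * p * q * r + 2 * a 2%N * r ^+ 2)).
Proof.
move=> Jx u1 den a p q r d e; have dia := cost_diamond w.2 Jx u1 den.
rewrite /cross D2_D1_D1_cost // D1_D2_D2_D1_cost //; set v := diamond _ _ _ _ in dia *.
have dia_eq eta := etrans (esym (D2_D1_cost v eta Jx))
  (etrans (dia eta) (D2_D2_D1_cost w.2 eta Jx)).
have := dia_eq w.1; have := dia_eq x; rewrite -!/(a _) -/p -/q -/r => Hd He.
have dE : <|x, v|> = d.
  by apply/(mulfI den); rewrite -!/(a _) /d mulrCA divff // mulr1; lra.
have eE : <|w.1, v|> = e.
  apply/(mulfI u1); rewrite -!/(a _) /e -dE mulrCA divff // mulr1; lra.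
by rewrite dE eE.
Qed.

End CostDerivatives.

(** * Elimination of the derivatives of u *)

(** The four jet identities are triangular in [a1], ..., [a4] with pivot [S1], so each [ai] is
    rational in the [Si]. Also [a2 * S0 + a1 = (S1 ^+ 2 - S0 * S2) / S1 ^+ 3], so the nondegeneracy
    condition on u is the one assumed on s. *)
Lemma cross_algebra {R : realType} {S0 S1 S2 S3 S4 a1 a2 a3 a4 : R} (p q r : R) :
    S1 != 0 -> S1 ^+ 2 - S0 * S2 != 0 ->
    S1 * a1 = 1 -> S2 * a1 ^+ 2 + S1 * a2 = 0 ->
    S3 * a1 ^+ 3 + 3 * (S2 * a1 * a2) + S1 * a3 = 0 ->
    S4 * a1 ^+ 4 + 6 * (S3 * a1 ^+ 2 * a2) + S2 * (3 * a2 ^+ 2 + 4 * (a1 * a3))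
      + S1 * a4 = 0 ->
  let d := q ^+ 2 * (a3 * S0 + 2 * a2) / (a2 * S0 + a1) in
  let e := (a3 * p * q ^+ 2 + 2 * a2 * q * r - a2 * p * d) / a1 in
  let K := - (a2 * (p * q) + a1 * r) in
  [/\ a1 != 0, a2 * S0 + a1 != 0 &
  1 / 2 * (a3 * p ^+ 2 * d + 2 * a2 * p * e
    - (a4 * (p * q) ^+ 2 + 4 * a3 * p * q * r + 2 * a2 * r ^+ 2)) =
  ((S1 ^+ 2 - S0 * S2) * S4 + S0 * S3 ^+ 2 - 2 * S1 * S2 * S3 + S2 ^+ 3)
    / (2 * (S1 ^+ 2 - S0 * S2) * S1 ^+ 5) * (p * q) ^+ 2
  - 2 * (S1 * S3 - S2 ^+ 2) / S1 ^+ 4 * (p * q) * K + S2 / S1 * K ^+ 2].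
Proof.
move=> S1n den e1 e2 e3 e4.
have solve y b : y + S1 * b = 0 -> b = - y / S1.
  by move=> E; apply/(mulfI S1n); rewrite mulrCA divff // mulr1; lra.
have A1 : a1 = S1^-1 by apply/(mulfI S1n); rewrite divff.
have A2 := solve _ _ e2; rewrite A1 in A2.
have A3 := solve _ _ e3; rewrite A1 A2 in A3.
have A4 := solve _ _ e4; rewrite A1 A2 A3 in A4.
have den' : a2 * S0 + a1 = (S1 ^+ 2 - S0 * S2) / S1 ^+ 3 by rewrite A2 A1; field.
move=> d e K; split; first by rewrite A1 invr_eq0.
  by rewrite den' mulf_neq0 // invr_eq0 expf_neq0.
rewrite /e /d /K den' A4 A3 A2 A1; field.
by rewrite den S1n.
Qed.

(** * The cross-curvature in terms of the derivatives of s *)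

Section CrossFormula.
Set Implicit Arguments.
Unset Strict Implicit.
Variables (R : realType) (n : nat) (A : 'M[R]_n) (J : set R) (U S : nat -> R -> R).
Hypotheses (Au : A \in unitmx) (As : A^T = A) (oJ : open J).
Hypothesis dU : forall i t, (i < 4)%N -> J t -> is_derive t 1 (U i) (U i.+1 t).
Hypothesis dS : forall i t, (i < 4)%N -> J t -> is_derive t 1 (S i) (S i.+1 t * U 1%N t).
Hypothesis S0 : forall t, J t -> S 0%N t = t.
Local Notation c := (fun x xb : 'cV[R]_n => U 0%N (tprod A x xb)).

(** The explicit value of [KM] and [U 1%N t != 0] are recorded too, since they serve to construct
    null vectors. *)
Lemma cross_formula x xb :
    let t := tprod A x xb in
    J t -> S 1%N t != 0 -> S 1%N t ^+ 2 - S 0%N t * S 2%N t != 0 ->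
  [/\ KM_nondegenerate c x xb, U 1%N t != 0 &
  forall w : 'cV[R]_n * 'cV[R]_n,
    let ab := tprod A w.1 xb * tprod A w.2 x in
    KM c x xb w w = - (U 2%N t * ab + U 1%N t * tprod A w.1 w.2) /\
    cross c x xb w =
      ((S 1%N t ^+ 2 - S 0%N t * S 2%N t) * S 4%N t + S 0%N t * S 3%N t ^+ 2
         - 2 * S 1%N t * S 2%N t * S 3%N t + S 2%N t ^+ 3)
        / (2 * (S 1%N t ^+ 2 - S 0%N t * S 2%N t) * S 1%N t ^+ 5) * ab ^+ 2
      - 2 * (S 1%N t * S 3%N t - S 2%N t ^+ 2) / S 1%N t ^+ 4 * ab * KM c x xb w w
      + S 2%N t / S 1%N t * KM c x xb w w ^+ 2].
Proof.
move=> t Jt S1n den; have [e1 e2 e3 e4] := inverse_jet oJ dU dS S0 Jt.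
have alg p q r := cross_algebra p q r S1n den e1 e2 e3 e4.
have [u1 uden _] := alg 0 0 0; rewrite (S0 Jt) in uden.
split=> // [|w ab]; first exact: (cost_KM_nondegenerate oJ dU Au As).
have KE : KM c x xb w w = - (U 2%N t * ab + U 1%N t * tprod A w.1 w.2).
  by rewrite (KM_cost oJ dU) // -/t /ab (tprodC w.2 x As); field.
split=> //; rewrite (cross_cost oJ dU) // KE /ab (tprodC w.2 x As).
have [_ _] := alg (tprod A w.1 xb) (tprod A x w.2) (tprod A w.1 w.2).
by rewrite -/t !(S0 Jt).
Qed.

End CrossFormula.

(** * From jets at a point to the sign of the cross-curvature on [N] *)

Theorem theorem1 (R : realType) (n : nat) (A : 'M[R]_n) (I : set R)
  (u s : R -> R) (N : set ('cV[R]_n * 'cV[R]_n)) :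
  (2 <= n)%N ->
  A \in unitmx -> A^T = A ->
  is_interval I -> monotonic_on I u -> Ck_on 4 I u ->
  Ck_on 4 (u @` I) s -> {in I, cancel u s} ->
  open N ->
  (forall x xb, N (x, xb) -> I (tprod A x xb)) ->
  (forall x xb, N (x, xb) -> (s^`(1) (u (tprod A x xb)))%classic != 0) ->
  (forall x xb, N (x, xb) -> mtw_den s (u (tprod A x xb)) != 0) ->
  let c := fun x xb : 'cV[R]_n => u (tprod A x xb) in
  [/\
    (* the cross-curvature is defined on N and given by the formula *)
    forall x xb, N (x, xb) ->
      KM_nondegenerate c x xb /\
      forall w : 'cV[R]_n * 'cV[R]_n,
      let s1 := (s^`(1) (u (tprod A x xb)))%classic in
      let s2 := (s^`(2) (u (tprod A x xb)))%classic in
      let s3 := (s^`(3) (u (tprod A x xb)))%classic in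
      let ab := tprod A w.1 xb * tprod A w.2 x in
      cross c x xb w =
        mtw_coef s (u (tprod A x xb)) * ab ^+ 2
        - 2 * (s1 * s3 - s2 ^+ 2) / s1 ^+ 4 * ab * KM c x xb w w
        + s2 / s1 * KM c x xb w w ^+ 2,
    (* sign on a given null vector; the cross-curvature vanishes if ab = 0 *)
    forall x xb, N (x, xb) ->
      forall w, null_vector c x xb w ->
      (0 <= cross c x xb w <->
       tprod A w.1 xb * tprod A w.2 x = 0 \/
       0 <= mtw_coef s (u (tprod A x xb))),
    (* sign on all null vectors, at a given point *)
    forall x xb, N (x, xb) -> x != 0 -> xb != 0 ->
      ((forall w, null_vector c x xb w -> 0 <= cross c x xb w) <->
       0 <= mtw_coef s (u (tprod A x xb))),
    (* sign on all null vectors, over N *)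
    (forall x xb, N (x, xb) ->
       forall w, null_vector c x xb w -> 0 <= cross c x xb w) <->
    (forall x xb, N (x, xb) -> 0 <= mtw_coef s (u (tprod A x xb)))
  & (* the ODE case *)
    (forall t, (u @` I)° t -> mtw_num s t = 0) ->
    forall x xb, N (x, xb) ->
      forall w, null_vector c x xb w -> cross c x xb w = 0].

Proof.
move=> n2 Au As _ um uC sC us oN NI s1N denN c.
have [uc _ _] := uC.
have uinj : {in I &, injective u} by move=> p q Ip Iq /(congr1 s); rewrite !us.
have NJ x xb : N (x, xb) -> I° (tprod A x xb) by exact: (tprod_interior n2 Au As oN NI).
have du i r : (i < 4)%N -> I° r ->
    is_derive r 1 (u^`(i))%classic ((u^`(i.+1))%classic r).
  by move=> i4 Ir; exact: Ck_is_derive uC i4 Ir.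
have img r : I° r -> (u @` I)° (u r) by exact: interior_image.
pose U i r := (u^`(i))%classic r; pose S i r := (s^`(i))%classic (u r).
have dS i r : (i < 4)%N -> I° r -> is_derive r 1 (S i) (S i.+1 r * U 1%N r).
  move=> i4 Ir; apply: (@is_derive1_comp _ (s^`(i))%classic u).
    exact: Ck_is_derive sC i4 (img r Ir).
  exact: (du 0%N).
have S0 r : I° r -> S 0%N r = r by move=> /interior_subset Ir; rewrite /S /= us ?inE.
have main x xb (Nx : N (x, xb)) := @cross_formula R n A I° U S Au As
  (@open_interior _ I) du dS S0 x xb (NJ _ _ Nx) (s1N _ _ Nx) (denN _ _ Nx).
have null x xb w : N (x, xb) -> null_vector c x xb w ->
    cross c x xb w =
      mtw_coef s (u (tprod A x xb)) * (tprod A w.1 xb * tprod A w.2 x) ^+ 2.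
  move=> Nx w0; have [_ _ /(_ w)[_ ->]] := main x xb Nx.
  by rewrite -/c w0 mulr0 subr0 expr0n mulr0 addr0.
have sign x xb : N (x, xb) -> x != 0 -> xb != 0 ->
    (forall w, null_vector c x xb w -> 0 <= cross c x xb w) ->
    0 <= mtw_coef s (u (tprod A x xb)).
  move=> Nx x0 xb0 H; have [_ u1 KE] := main x xb Nx.
  set t := tprod A x xb in u1 KE *.
  (* The ratio -u''/u' makes u'' p q + u' r vanish, so [w] is null while p q is nonzero. *)
  have [w [w1 w2 w12]] := exists_tprod_pair (- U 2%N t / U 1%N t) n2 Au As x0 xb0.
  have w0 : null_vector c x xb w.
    rewrite /null_vector; have [-> _] := KE w.
    by rewrite w12; field.
  have := H w w0; rewrite null // pmulr_lge0 //.
  by rewrite lt0r sqr_ge0 andbT expf_neq0 // mulf_neq0.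
split.
- move=> x xb Nx; have [nd _ F] := main x xb Nx.
  by split => // w; have [_ ->] := F w.
- move=> x xb Nx w w0; rewrite null //; split => [|[->|k0]].
  + have [->|ab0] := eqVneq (tprod A w.1 xb * tprod A w.2 x) 0; first by left.
    by rewrite pmulr_lge0 ?lt0r ?sqr_ge0 ?andbT ?expf_neq0 //; right.
  + by rewrite expr0n mulr0.
  + by rewrite mulr_ge0 // sqr_ge0.
- move=> x xb Nx x0 xb0; split; first exact: sign.
  by move=> k0 w w0; rewrite null // mulr_ge0 // sqr_ge0.
- split=> [H x xb Nx|k0 x xb Nx w w0]; last by rewrite null // mulr_ge0 ?sqr_ge0 ?k0.
  (* The coefficient depends on the point only through t, so it may be tested at a pair of nonzero
     vectors with the same t. *)
  have [y [yb [Ny y0 yb0 <-]]] := exists_nonzero_same_tprod n2 As oN Nx.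
  exact: sign (H _ _ Ny).
- move=> ode x xb Nx w w0.
  (* The ODE is assumed on the interior of the range of [u]; u(t) lies there because t is interior
     to [I]. *)
  by rewrite null // /mtw_coef ode ?mul0r //; apply: img; exact: NJ.
Qed.
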